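(* Let $k$ be a field and let $\mathcal{B}$ be a $k$-category such that the endomorphism ring of each object is reduced to $k$, and let $b_0$ be an object of $\mathcal{B}$. Assume that $\mathcal{B}$ admits a Galois covering $F$ whose group $\mathrm{Aut}_1(F)$ is isomorphic to $\pi_1(\mathcal{B},b_0)$ (for instance if $\mathcal{B}$ admits a universal covering). Then there exists a canonical injective ($k$-linear) morphism $$\Delta:\mathrm{Hom}(\pi_1(\mathcal{B},b_0),k^+)\longrightarrow H^1(\mathcal{B},\mathcal{B}).$$
   Context: A $k$-category is a small category $\mathcal{B}$ with object set $\mathcal{B}_0$, in which each morphism set ${}_y\mathcal{B}_x$ from $x$ to $y$ is a $k$-module, composition is $k$-bilinear, and $k$-multiples of the identity at each object are central in its endomorphism ring. A $k$-functor is a functor that is $k$-linear on morphisms. The star at an object $b_0$ is $\mathrm{St}_{b_0}\mathcal{B}=\left(\bigoplus_{y\in\mathcal{B}_0}{}_y\mathcal{B}_{b_0}\right)\oplus\left(\bigoplus_{y\in\mathcal{B}_0}{}_{b_0}\mathcal{B}_y\right)$. A $k$-functor $F:\mathcal{C}\to\mathcal{B}$ is a covering if it is surjective on objects and, for each $b_0\in\mathcal{B}_0$ and each $x\in F^{-1}(b_0)$, the map $\mathrm{St}_x\mathcal{C}\to\mathrm{St}_{b_0}\mathcal{B}$ induced by $F$ is an isomorphism of $k$-modules. A $k$-category $\mathcal{B}$ is connected if for any two objects $b,c$ there is a finite sequence of objects $b=x_1,\dots,x_n=c$ such that for each $1\le i<n$ there is a non-zero morphism in ${}_{x_{i+1}}\mathcal{B}_{x_i}$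 or in ${}_{x_i}\mathcal{B}_{x_{i+1}}$. A morphism from a covering $F:\mathcal{C}\to\mathcal{B}$ to a covering $G:\mathcal{D}\to\mathcal{B}$ is a pair $(H,J)$ of $k$-functors $H:\mathcal{C}\to\mathcal{D}$, $J:\mathcal{B}\to\mathcal{B}$ with $J$ an isomorphism that is the identity on objects and $GH=JF$. $\mathrm{Aut}_1(F)$ is the group of automorphisms of $F$ of the form $(H,1)$, i.e. of automorphisms $H$ of $\mathcal{C}$ with $FH=F$. A covering $F:\mathcal{C}\to\mathcal{B}$ is a Galois covering if $\mathcal{C}$ is connected and $\mathrm{Aut}_1(F)$ acts transitively on some fibre $F^{-1}(b)$. $\mathrm{Gal}(\mathcal{B})$ is the full subcategory of Galois coverings in the category of coverings of $\mathcal{B}$. A universal covering is an object $U:\mathcal{U}\to\mathcal{B}$ of $\mathrm{Gal}(\mathcal{B})$ such that for any Galois covering $F:\mathcal{C}\to\mathcal{B}$ and any $u_0\in\mathcal{U}_0$, $c_0\in\mathcal{C}_0$ with $U(u_0)=F(c_0)$, there is a unique morphism of the form $(H,1)$ from $U$ to $F$ with $H(u_0)=c_0$. $\mathrm{Gal}(\mathcal{B},b_0)$ is the subcategory of $\mathrm{Gal}(\mathcal{B})$ with the same objects and with morphisms the $(H,J)$ such that $J(b_0)=b_0$. The fibre functor $\Phi:\mathrm{Gal}(\mathcal{B},b_0)\to\mathrm{Sets}$ sends $F$ to $F^{-1}(b_0)$ and $(H,J)$ to the restriction of $H$. The fundamental group $\pi_1(\mathcal{B},b_0)$ is the group of natural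 automorphisms of $\Phi$. $k^+$ is the additive group of $k$ and $\mathrm{Hom}(\Gamma,k^+)$ is the $k$-vector space of group homomorphisms $\Gamma\to k^+$. The endomorphism ring of $b$ is reduced to $k$ if ${}_b\mathcal{B}_b=k\cdot 1_b\cong k$. A derivation of $\mathcal{B}$ is a collection $D=({}_cD_b)_{c,b\in\mathcal{B}_0}$ of $k$-linear endomorphisms of the $k$-modules ${}_c\mathcal{B}_b$ such that $D(gf)=gD(f)+D(g)f$ for all composable morphisms. The inner derivation associated with a family $\alpha=(\alpha_b)_{b\in\mathcal{B}_0}$, $\alpha_b\in{}_b\mathcal{B}_b$, is $D_\alpha(f)=\alpha_c f-f\alpha_b$ for $f\in{}_c\mathcal{B}_b$. The first Hochschild(-Mitchell) cohomology $H^1(\mathcal{B},\mathcal{B})$ is the quotient of the $k$-module of derivations by the inner ones. The word ''canonical'' refers to the map obtained, through the isomorphism $\mathrm{Aut}_1(F)\simeq\pi_1(\mathcal{B},b_0)$, from the following map $\mathrm{Hom}(\mathrm{Aut}_1(F),k^+)\to H^1(\mathcal{B},\mathcal{B})$. A choice of objects $x_b\in F^{-1}(b)$, $b\in\mathcal{B}_0$, yields decompositions ${}_c\mathcal{B}_b=\bigoplus_{s\in\mathrm{Aut}_1(F)}Z_s({}_c\mathcal{B}_b)$ with $Z_s({}_c\mathcal{B}_b)=F({}_{sx_c}\mathcal{C}_{x_b})$, and $\chi$ is sent to the class of the derivation given by $f\mapsto\chi(s)f$ for $f\in Z_s({}_c\mathcal{B}_b)$; this class does not depend on the choice of the objects $x_b$.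 *)

(* Defs.v *)
From HB Require Import structures.
From mathcomp Require Import all_boot all_algebra.
From mathcomp Require Import boolp classical_sets functions cardinality fsbigop.

Set Implicit Arguments.
Unset Strict Implicit.
Unset Printing Implicit Defensive.

Import GRing.Theory.
Local Open Scope ring_scope.

(* [khom x y] is the module of morphisms from x to y. Its carrier and its
   module structure are separate fields, instead of one field in
   [ob -> ob -> lmodType k], so that [kcat k] does not live above the universe
   of the carriers of [lmodType]: the fundamental group below quantifies over
   [kcat k], and must itself carry MathComp structures. *)
Record kcat (k : fieldType) := KCat {
  ob : Type;
  khom : ob -> ob -> Type;
  hom_lmod : forall x y, GRing.Lmodule k (khom x y);
  idm : forall x, khom x x;
  cmp : forall x y z, khom y z -> khom x y -> khom x z;
  cmp_linearr : forall x y z (g : khom y z),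
    linear (cmp g : GRing.Lmodule.Pack (hom_lmod x y)
                    -> GRing.Lmodule.Pack (hom_lmod x z));
  cmp_linearl : forall x y z (f : khom x y),
    linear ((fun g => cmp g f) : GRing.Lmodule.Pack (hom_lmod y z)
                                 -> GRing.Lmodule.Pack (hom_lmod x z));
  cmpA : forall w x y z (h : khom y z) (g : khom x y) (f : khom w x),
    cmp h (cmp g f) = cmp (cmp h g) f;
  cmp1m : forall x y (f : khom x y), cmp (idm y) f = f;
  cmpm1 : forall x y (f : khom x y), cmp f (idm x) = f }.

Arguments idm {k B} x : rename.
Arguments cmp {k B x y z} g f : rename.

HB.instance Definition _ (k : fieldType) (B : kcat k) (x y : ob B) :=
  hom_lmod x y.

Section KCatTheory.
Variables (k : fieldType) (B : kcat k).
Implicit Types x y z : ob B.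

Lemma cmpDr x y z (g : khom y z) (f f' : khom x y) :
  cmp g (f + f') = cmp g f + cmp g f'.
Proof. by have := cmp_linearr g 1 f f'; rewrite !scale1r. Qed.

Lemma cmpDl x y z (g g' : khom y z) (f : khom x y) :
  cmp (g + g') f = cmp g f + cmp g' f.
Proof. by have := cmp_linearl f 1 g g'; rewrite !scale1r. Qed.

Lemma cmpm0 x y z (g : khom y z) : cmp g (0 : khom x y) = 0.
Proof. by apply: (addrI (cmp g 0)); rewrite -cmpDr !addr0. Qed.

Lemma cmp0m x y z (f : khom x y) : cmp (0 : khom y z) f = 0.
Proof. by apply: (addrI (cmp 0 f)); rewrite -cmpDl !addr0. Qed.

Lemma cmpZr x y z (a : k) (g : khom y z) (f : khom x y) :
  cmp g (a *: f) = a *: cmp g f.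
Proof. by have := cmp_linearr g a f 0; rewrite cmpm0 !addr0. Qed.

Lemma cmpZl x y z (a : k) (g : khom y z) (f : khom x y) :
  cmp (a *: g) f = a *: cmp g f.
Proof. by have := cmp_linearl f a g 0; rewrite cmp0m !addr0. Qed.

Lemma cmpNr x y z (g : khom y z) (f : khom x y) : cmp g (- f) = - cmp g f.
Proof. by rewrite -scaleN1r cmpZr scaleN1r. Qed.

Lemma cmpNl x y z (g : khom y z) (f : khom x y) : cmp (- g) f = - cmp g f.
Proof. by rewrite -scaleN1r cmpZl scaleN1r. Qed.

Lemma scaled_idm_central x (a : k) (f : khom x x) :
  cmp (a *: idm x) f = cmp f (a *: idm x).
Proof. by rewrite cmpZl cmpZr cmp1m cmpm1. Qed.

Definition end_reduced x := bijective (fun a : k => a *: idm x).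

Definition adjacent x y :=
  (exists f : khom x y, f != 0) \/ (exists f : khom y x, f != 0).

Definition kconnected := forall x y, exists n (p : nat -> ob B),
  [/\ p 0%N = x, p n = y & forall i, (i < n)%N -> adjacent (p i) (p i.+1)].

Definition hcast x x' y y' (ex : x = x') (ey : y = y') (f : khom x y) :
    khom x' y' :=
  ecast v (khom x' v) ey (ecast u (khom u y) ex f).

End KCatTheory.

Arguments kconnected {k} B.

Record kfunctor (k : fieldType) (C B : kcat k) := KFunctor {
  fob :> ob C -> ob B;
  fmap : forall x y, khom x y -> khom (fob x) (fob y);
  fmap_linear : forall x y, linear (@fmap x y);
  fmap1 : forall x, fmap (idm x) = idm (fob x);
  fmap_cmp : forall x y z (g : khom y z) (f : khom x y),
    fmap (cmp g f) = cmp (fmap g) (fmap f) }.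

Section KFunctorTheory.
Variables (k : fieldType).

(* Functors are compared with Leibniz equality: by function extensionality and
   proof irrelevance it is equality on objects and on morphisms. *)
Definition fid (C : kcat k) : kfunctor C C :=
  @KFunctor k C C id (fun x y f => f) (fun _ _ _ _ _ => erefl)
    (fun _ => erefl) (fun _ _ _ _ _ => erefl).

Program Definition fcomp (C D E : kcat k) (G : kfunctor D E)
    (F : kfunctor C D) : kfunctor C E :=
  @KFunctor k C E (fun x => G (F x)) (fun x y f => fmap G (fmap F f)) _ _ _.
Next Obligation. by move=> a f g; rewrite !fmap_linear. Qed.
Next Obligation. by rewrite !fmap1. Qed.
Next Obligation. by rewrite !fmap_cmp. Qed.

Lemma kfunctor_eq (C B : kcat k) (F G : kfunctor C B)
    (eFG : fob F = fob G) :
  ecast h (forall x y, khom x y -> khom (h x) (h y)) eFG (fmap F) = fmap G ->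
  F = G.
Proof.
case: F eFG => f m ml m1 mc; case: G => f' m' ml' m1' mc' /= e.
case: f' / e m' ml' m1' mc' => m' ml' m1' mc' /= e.
case: m' / e ml' m1' mc' => *.
by congr KFunctor; exact: Prop_irrelevance.
Qed.

Lemma fcompA (A C D E : kcat k) (H : kfunctor D E) (G : kfunctor C D)
    (F : kfunctor A C) : fcomp H (fcomp G F) = fcomp (fcomp H G) F.
Proof.
exact: (@kfunctor_eq _ _ (fcomp H (fcomp G F)) (fcomp (fcomp H G) F) erefl).
Qed.

Lemma fcomp1f (C D : kcat k) (F : kfunctor C D) : fcomp (fid D) F = F.
Proof. exact: (@kfunctor_eq _ _ (fcomp (fid D) F) F erefl). Qed.

Lemma fcompf1 (C D : kcat k) (F : kfunctor C D) : fcomp F (fid C) = F.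
Proof. exact: (@kfunctor_eq _ _ (fcomp F (fid C)) F erefl). Qed.

Definition fiso (C D : kcat k) (F : kfunctor C D) :=
  exists G : kfunctor D C, fcomp G F = fid C /\ fcomp F G = fid D.

End KFunctorTheory.

Record dsum (k : fieldType) (I : Type) (M : I -> lmodType k) := DSum {
  dval :> forall i, M i;
  dfin : finite_set [set i | dval i != 0] }.

HB.instance Definition _ k I M := gen_eqMixin (@dsum k I M).
HB.instance Definition _ k I M := gen_choiceMixin (@dsum k I M).

Section DirectSum.
Variables (k : fieldType) (I : Type) (M : I -> lmodType k).
Local Notation S := (dsum M).

Lemma dsum_eq (u v : S) : (forall i, u i = v i) -> u = v.
Proof.
case: u v => [u hu] [v hv] /= uv.
have e : u = v by apply: functional_extensionality_dep.
move=> {uv}.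
by case: v / e hv => hv; congr DSum; exact: Prop_irrelevance.
Qed.

Program Definition dsum0 : S := @DSum k I M (fun=> 0) _.
Next Obligation.
by apply: sub_finite_set (finite_set0 I) => i /=; rewrite eqxx.
Qed.

Program Definition dsumN (u : S) : S := @DSum k I M (fun i => - u i) _.
Next Obligation.
by apply: sub_finite_set (dfin u) => i /=; rewrite oppr_eq0.
Qed.

Program Definition dsumD (u v : S) : S := @DSum k I M (fun i => u i + v i) _.
Next Obligation.
apply: (@sub_finite_set _ _
  ([set i | u i != 0] `|` [set i | v i != 0])%classic).
  move=> i /= h; apply/orP; rewrite -negb_and; apply: contra h.
  by move=> /andP[/eqP-> /eqP->]; rewrite addr0.
by rewrite finite_setU; split; exact: dfin.
Qed.

Program Definition dsumZ (a : k) (u : S) : S :=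
  @DSum k I M (fun i => a *: u i) _.
Next Obligation.
apply: sub_finite_set (dfin u) => i /=; apply: contra => /eqP->.
by rewrite scaler0.
Qed.

Lemma dsumDA : associative dsumD.
Proof. by move=> u v w; apply: dsum_eq => i /=; rewrite addrA. Qed.
Lemma dsumDC : commutative dsumD.
Proof. by move=> u v; apply: dsum_eq => i /=; rewrite addrC. Qed.
Lemma dsum0D : left_id dsum0 dsumD.
Proof. by move=> u; apply: dsum_eq => i /=; rewrite add0r. Qed.
Lemma dsumND : left_inverse dsum0 dsumN dsumD.
Proof. by move=> u; apply: dsum_eq => i /=; rewrite addNr. Qed.
HB.instance Definition _ :=
  GRing.isZmodule.Build S dsumDA dsumDC dsum0D dsumND.

Lemma dsumZA a b u : dsumZ a (dsumZ b u) = dsumZ (a * b) u.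
Proof. by apply: dsum_eq => i /=; rewrite scalerA. Qed.
Lemma dsum1Z : left_id 1 dsumZ.
Proof. by move=> u; apply: dsum_eq => i /=; rewrite scale1r. Qed.
Lemma dsumZDr : right_distributive dsumZ +%R.
Proof. by move=> a u v; apply: dsum_eq => i /=; rewrite scalerDr. Qed.
Lemma dsumZDl u : {morph dsumZ^~ u : a b / a + b}.
Proof. by move=> a b; apply: dsum_eq => i /=; rewrite scalerDl. Qed.
HB.instance Definition _ :=
  GRing.Zmodule_isLmodule.Build k S dsumZA dsum1Z dsumZDr dsumZDl.

Definition single i (m : M i) j : M j :=
  if pselect (i = j) is left e then ecast l (M l) e m else 0.

Lemma single_fin i (m : M i) : finite_set [set j | single m j != 0].
Proof.
apply: sub_finite_set (finite_set1 i) => j /=; rewrite /single.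
by case: pselect => [|_] /=; [move=> ij _; rewrite ij | rewrite eqxx].
Qed.

Definition dinj i (m : M i) : S := DSum (single_fin m).

Lemma dinj_linear i : linear (@dinj i).
Proof.
move=> a m m'; apply: dsum_eq => j /=; rewrite /single.
case: pselect => [e|_]; last by rewrite addr0 scaler0.
by case: j / e.
Qed.

HB.instance Definition _ i :=
  GRing.isLinear.Build k (M i) S _ (@dinj i) (@dinj_linear i).

Definition dlift (N : lmodType k) (h : forall i, {linear M i -> N}) (u : S) :
    N :=
  \sum_(i \in [set: {classic I}]) h i (u i).

Lemma dliftE (N : lmodType k) (h : forall i, {linear M i -> N}) (u : S)
    (A : set {classic I}) : finite_set A ->
  ([set i | u i != 0] `<=` A)%classic -> dlift h u = \sum_(i \in A) h i (u i).
Proof.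
move=> finA uA; apply/esym/fsbig_widen => // i [_ /= nAi].
have [->|ui] := eqVneq (u i) 0; first by rewrite linear0.
by case: nAi; apply: uA.
Qed.

Lemma dlift_linear (N : lmodType k) (h : forall i, {linear M i -> N}) :
  linear (dlift h).
Proof.
move=> a u v.
pose A : set {classic I} :=
  ([set i | u i != 0] `|` [set i | v i != 0])%classic.
have finA : finite_set A by rewrite finite_setU; split; exact: dfin.
rewrite !(@dliftE N h _ A) //; do ?by move=> i /= hi; [left|right|].
  rewrite !fsbig_finite // scaler_sumr -big_split /=.
  by apply: eq_bigr => i _; rewrite linearP.
- by move=> i hi; right.
- by move=> i hi; left.
move=> i /= h0; apply/orP; rewrite -negb_and; apply: contra h0.
by move=> /andP[/eqP-> /eqP->]; rewrite scaler0 addr0.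
Qed.

HB.instance Definition _ (N : lmodType k) (h : forall i, {linear M i -> N}) :=
  GRing.isLinear.Build k S N _ (dlift h) (dlift_linear h).

Lemma single_id i (m : M i) : single m i = m.
Proof.
by rewrite /single; case: pselect => // e; rewrite (Prop_irrelevance e erefl).
Qed.

Lemma dlift_dinj (N : lmodType k) (h : forall i, {linear M i -> N})
    i (m : M i) :
  dlift h (dinj m) = h i m.
Proof.
rewrite (@dliftE N h _ [set i]%classic).
- by rewrite fsbig_set1 /= single_id.
- exact: finite_set1.
move=> j /=; rewrite /single.
by case: pselect => [|_] /=; [move=> ij _; rewrite ij | rewrite eqxx].
Qed.

End DirectSum.

HB.instance Definition _ (k : fieldType) (C B : kcat k) (F : kfunctor C B)
    (x y : ob C) :=
  GRing.isLinear.Build k (khom x y) (khom (F x) (F y)) _ (@fmap k C B F x y)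
    (@fmap_linear k C B F x y).

Section Coverings.
Variables (k : fieldType).
Implicit Types B C D : kcat k.

Definition star_out B (b : ob B) : lmodType k :=
  dsum (fun y => khom b y : lmodType k).
Definition star_in B (b : ob B) : lmodType k :=
  dsum (fun y => khom y b : lmodType k).
Definition star B (b : ob B) : lmodType k := (star_out b * star_in b)%type.

Section StarMap.
Variables (C B : kcat k) (F : kfunctor C B) (x : ob C).

Definition fmap_out y (f : khom x y) : star_out (F x) :=
  @dinj k (ob B) (fun b => khom (F x) b : lmodType k) (F y) (fmap F f).

Definition fmap_in y (f : khom y x) : star_in (F x) :=
  @dinj k (ob B) (fun b => khom b (F x) : lmodType k) (F y) (fmap F f).

Lemma fmap_out_linear y : linear (@fmap_out y).
Proof. by move=> a f g; rewrite /fmap_out fmap_linear dinj_linear. Qed.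

Lemma fmap_in_linear y : linear (@fmap_in y).
Proof. by move=> a f g; rewrite /fmap_in fmap_linear dinj_linear. Qed.

HB.instance Definition _ y :=
  GRing.isLinear.Build k (khom x y) (star_out (F x)) _ (@fmap_out y)
    (@fmap_out_linear y).
HB.instance Definition _ y :=
  GRing.isLinear.Build k (khom y x) (star_in (F x)) _ (@fmap_in y)
    (@fmap_in_linear y).

Definition star_map (u : star x) : star (F x) :=
  (@dlift k (ob C) (fun y => khom x y : lmodType k) _
     (fun y => @fmap_out y : {linear _ -> _}) u.1,
   @dlift k (ob C) (fun y => khom y x : lmodType k) _
     (fun y => @fmap_in y : {linear _ -> _}) u.2).

Lemma star_map_linear : linear star_map.
Proof. by move=> a u v; congr pair; apply: dlift_linear. Qed.

HB.instance Definition _ :=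
  GRing.isLinear.Build k (star x) (star (F x)) _ star_map star_map_linear.

Lemma star_map_out y (f : khom x y) :
  star_map (@dinj k (ob C) (fun y => khom x y : lmodType k) y f, 0) =
  (fmap_out f, 0).
Proof. by rewrite /star_map /= linear0 dlift_dinj. Qed.

Lemma star_map_in y (f : khom y x) :
  star_map (0, @dinj k (ob C) (fun y => khom y x : lmodType k) y f) =
  (0, fmap_in f).
Proof. by rewrite /star_map /= linear0 dlift_dinj. Qed.

End StarMap.

Definition is_covering C B (F : kfunctor C B) :=
  (forall b, exists x, F x = b) /\ (forall x, bijective (@star_map C B F x)).

Definition fibre C B (F : kfunctor C B) (b : ob B) := {x : ob C | F x = b}.

End Coverings.

Record aut1 (k : fieldType) (C B : kcat k) (F : kfunctor C B) := Aut1 {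
  aut1_fun :> kfunctor C C;
  aut1_inv : kfunctor C C;
  aut1_invK : fcomp aut1_inv aut1_fun = fid C;
  aut1_funK : fcomp aut1_fun aut1_inv = fid C;
  aut1_over : fcomp F aut1_fun = F }.

HB.instance Definition _ k C B F := gen_eqMixin (@aut1 k C B F).
HB.instance Definition _ k C B F := gen_choiceMixin (@aut1 k C B F).

Section Aut1Group.
Variables (k : fieldType) (C B : kcat k) (F : kfunctor C B).
Implicit Types s t : aut1 F.

Lemma aut1_eq s t : aut1_fun s = aut1_fun t -> s = t.
Proof.
case: s t => s s' sK sK' sF [t t' tK tK' tF] /= e.
case: t / e tK tK' tF => tK tK' tF.
have e : s' = t' by rewrite -[LHS]fcompf1 -tK' fcompA sK fcomp1f.
case: t' / e tK tK' => tK tK'.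
by congr Aut1; exact: Prop_irrelevance.
Qed.

Definition aut1_one : aut1 F :=
  Aut1 (fcomp1f (fid C)) (fcomp1f (fid C)) (fcompf1 F).

Lemma aut1_mul_invK s t :
  fcomp (fcomp (aut1_inv t) (aut1_inv s)) (fcomp s t) = fid C.
Proof.
by rewrite -fcompA [fcomp (aut1_inv s) _]fcompA aut1_invK fcomp1f aut1_invK.
Qed.

Lemma aut1_mul_funK s t :
  fcomp (fcomp s t) (fcomp (aut1_inv t) (aut1_inv s)) = fid C.
Proof.
by rewrite -fcompA [fcomp t _]fcompA aut1_funK fcomp1f aut1_funK.
Qed.

Lemma aut1_mul_over s t : fcomp F (fcomp s t) = F.
Proof. by rewrite fcompA !aut1_over. Qed.

Definition aut1_mul s t : aut1 F :=
  Aut1 (aut1_mul_invK s t) (aut1_mul_funK s t) (aut1_mul_over s t).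

Lemma aut1_inv_over s : fcomp F (aut1_inv s) = F.
Proof. by rewrite -{1}(aut1_over s) -fcompA aut1_funK fcompf1. Qed.

Definition aut1_opp s : aut1 F :=
  Aut1 (aut1_funK s) (aut1_invK s) (aut1_inv_over s).

Lemma aut1_mulA : associative aut1_mul.
Proof. by move=> s t u; apply: aut1_eq; rewrite /= fcompA. Qed.
Lemma aut1_mul1 : left_id aut1_one aut1_mul.
Proof. by move=> s; apply: aut1_eq; rewrite /= fcomp1f. Qed.
Lemma aut1_1mul : right_id aut1_one aut1_mul.
Proof. by move=> s; apply: aut1_eq; rewrite /= fcompf1. Qed.
Lemma aut1_mulV : left_inverse aut1_one aut1_opp aut1_mul.
Proof. by move=> s; apply: aut1_eq; rewrite /= aut1_invK. Qed.
Lemma aut1_Vmul : right_inverse aut1_one aut1_opp aut1_mul.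
Proof. by move=> s; apply: aut1_eq; rewrite /= aut1_funK. Qed.

HB.instance Definition _ := isGroup.Build (aut1 F)
  aut1_mulA aut1_mul1 aut1_1mul aut1_mulV aut1_Vmul.

Lemma aut1_ob s x : F (s x) = F x.
Proof. by rewrite -[in RHS](aut1_over s). Qed.

Definition aut1_act s b (x : fibre F b) : fibre F b :=
  exist _ (s (sval x)) (etrans (aut1_ob s (sval x)) (svalP x)).

(* The morphism F f, moved to [khom b c] along F x = b and F y = c. *)
Definition fibre_map b c (x : fibre F b) (y : fibre F c)
    (f : khom (sval x) (sval y)) : khom b c :=
  hcast (svalP x) (svalP y) (fmap F f).

Definition transitive_fibre b :=
  forall x y : fibre F b, exists s : aut1 F, aut1_act s x = y.

(* Z_s of the morphisms from b to c: the image under F of the morphisms from x_b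
   to s x_c. *)
Definition homogeneous (x : forall b, fibre F b) s b c : set (khom b c) :=
  range (@fibre_map b c (x b) (aut1_act s (x c))).

End Aut1Group.

Definition galois_covering (k : fieldType) (C B : kcat k) (F : kfunctor C B) :=
  [/\ is_covering F, kconnected C & exists b, transitive_fibre F b].

Record galcov (k : fieldType) (B : kcat k) := GalCov {
  gal_cat : kcat k;
  gal_fun :> kfunctor gal_cat B;
  gal_galois : galois_covering gal_fun }.

(* [mor_point] follows from [mor_base_id]; it is what defines Gal(B, b0) inside
   Gal(B). *)
Record galmor (k : fieldType) (B : kcat k) (b0 : ob B) (F G : galcov B) :=
  GalMor {
    mor_top : kfunctor (gal_cat F) (gal_cat G);
    mor_base : kfunctor B B;
    mor_base_iso : fiso mor_base;
    mor_base_id : forall b, mor_base b = b;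
    mor_comm : fcomp G mor_top = fcomp mor_base F;
    mor_point : mor_base b0 = b0 }.

Section FundamentalGroup.
Variables (k : fieldType) (B : kcat k) (b0 : ob B).
Implicit Types F G : galcov B.

Lemma mor_top_ob F G (m : galmor b0 F G) (x : fibre F b0) :
  G (mor_top m (sval x)) = b0.
Proof.
have e : fcomp G (mor_top m) (sval x) = fcomp (mor_base m) F (sval x).
  by rewrite mor_comm.
by rewrite [LHS]e /= (svalP x) mor_point.
Qed.

Definition fibre_mor F G (m : galmor b0 F G) (x : fibre F b0) : fibre G b0 :=
  exist _ (mor_top m (sval x)) (mor_top_ob m x).

(* The natural automorphisms of the functor which sends F to [fibre F b0] and m
   to [fibre_mor m]. *)
Record pi1 := Pi1 {
  pi1_fun :> forall F, fibre F b0 -> fibre F b0;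
  pi1_inv : forall F, fibre F b0 -> fibre F b0;
  pi1_invK : forall F, cancel (@pi1_fun F) (@pi1_inv F);
  pi1_funK : forall F, cancel (@pi1_inv F) (@pi1_fun F);
  pi1_nat : forall F G (m : galmor b0 F G) (x : fibre F b0),
    pi1_fun (fibre_mor m x) = fibre_mor m (pi1_fun x) }.

HB.instance Definition _ := gen_eqMixin pi1.
HB.instance Definition _ := gen_choiceMixin pi1.

Implicit Types s t : pi1.

Lemma pi1_eq s t : (forall F (x : fibre F b0), s F x = t F x) -> s = t.
Proof.
case: s t => s s' sK sK' sN [t t' tK tK' tN] /= st.
have e : s = t.
  apply: functional_extensionality_dep => F.
  by apply: functional_extensionality_dep => x.
clear st; case: t / e tK tK' tN => tK tK' tN.
have e : s' = t'.
  apply: functional_extensionality_dep => F.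
  by apply: functional_extensionality_dep => x; rewrite -{1}[x]tK' sK.
case: t' / e tK tK' => tK tK'.
by congr Pi1; exact: Prop_irrelevance.
Qed.

Definition pi1_one : pi1 :=
  @Pi1 (fun F => id) (fun F => id) (fun _ _ => erefl) (fun _ _ => erefl)
    (fun _ _ _ _ => erefl).

Lemma pi1_mul_nat s t F G (m : galmor b0 F G) (x : fibre F b0) :
  s G (t G (fibre_mor m x)) = fibre_mor m (s F (t F x)).
Proof. by rewrite !pi1_nat. Qed.

Definition pi1_mul s t : pi1 :=
  @Pi1 (fun F => s F \o t F) (fun F => pi1_inv t (F := F) \o pi1_inv s (F := F))
    (fun F => can_comp (pi1_invK s (F := F)) (pi1_invK t (F := F)))
    (fun F => can_comp (pi1_funK t (F := F)) (pi1_funK s (F := F)))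
    (pi1_mul_nat s t).

Lemma pi1_inv_nat s F G (m : galmor b0 F G) (x : fibre F b0) :
  pi1_inv s (fibre_mor m x) = fibre_mor m (pi1_inv s x).
Proof.
by apply: (can_inj (pi1_invK s (F := G))); rewrite pi1_funK pi1_nat pi1_funK.
Qed.

Definition pi1_opp s : pi1 :=
  Pi1 (pi1_funK s) (pi1_invK s) (pi1_inv_nat s).

Lemma pi1_mulA : associative pi1_mul.
Proof. by move=> s t u; apply: pi1_eq. Qed.
Lemma pi1_mul1 : left_id pi1_one pi1_mul.
Proof. by move=> s; apply: pi1_eq. Qed.
Lemma pi1_1mul : right_id pi1_one pi1_mul.
Proof. by move=> s; apply: pi1_eq. Qed.
Lemma pi1_mulV : left_inverse pi1_one pi1_opp pi1_mul.
Proof. by move=> s; apply: pi1_eq => F x /=; rewrite pi1_invK. Qed.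
Lemma pi1_Vmul : right_inverse pi1_one pi1_opp pi1_mul.
Proof. by move=> s; apply: pi1_eq => F x /=; rewrite pi1_funK. Qed.

HB.instance Definition _ := isGroup.Build pi1
  pi1_mulA pi1_mul1 pi1_1mul pi1_mulV pi1_Vmul.

End FundamentalGroup.

Record addchar (k : fieldType) (G : groupType) := AddChar {
  addchar_fun :> G -> k;
  addcharM : forall s t : G,
    addchar_fun (s * t)%g = addchar_fun s + addchar_fun t }.

HB.instance Definition _ k G := gen_eqMixin (@addchar k G).
HB.instance Definition _ k G := gen_choiceMixin (@addchar k G).

Section AddChar.
Variables (k : fieldType) (G : groupType).
Implicit Types u v w : addchar k G.

Lemma addchar_eq u v : u =1 v -> u = v.
Proof.
case: u v => u uM [v vM] /= /funext e.
by case: v / e vM => vM; congr AddChar; exact: Prop_irrelevance.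
Qed.

Lemma addchar0_subproof (s t : G) : 0 = 0 + 0 :> k.
Proof. by rewrite addr0. Qed.
Definition addchar0 : addchar k G := AddChar addchar0_subproof.

Lemma addcharN_subproof u (s t : G) : - u (s * t)%g = - u s + - u t.
Proof. by rewrite addcharM opprD. Qed.
Definition addcharN u : addchar k G := AddChar (addcharN_subproof u).

Lemma addcharD_subproof u v (s t : G) :
  u (s * t)%g + v (s * t)%g = u s + v s + (u t + v t).
Proof. by rewrite !addcharM addrACA. Qed.
Definition addcharD u v : addchar k G := AddChar (addcharD_subproof u v).

Lemma addcharZ_subproof a u (s t : G) : a * u (s * t)%g = a * u s + a * u t.
Proof. by rewrite addcharM mulrDr. Qed.
Definition addcharZ a u : addchar k G := AddChar (addcharZ_subproof a u).

Lemma addcharDA : associative addcharD.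
Proof. by move=> u v w; apply: addchar_eq => s /=; rewrite addrA. Qed.
Lemma addcharDC : commutative addcharD.
Proof. by move=> u v; apply: addchar_eq => s /=; rewrite addrC. Qed.
Lemma addchar0D : left_id addchar0 addcharD.
Proof. by move=> u; apply: addchar_eq => s /=; rewrite add0r. Qed.
Lemma addcharND : left_inverse addchar0 addcharN addcharD.
Proof. by move=> u; apply: addchar_eq => s /=; rewrite addNr. Qed.
HB.instance Definition _ := GRing.isZmodule.Build (addchar k G)
  addcharDA addcharDC addchar0D addcharND.

Lemma addcharZA a b u : addcharZ a (addcharZ b u) = addcharZ (a * b) u.
Proof. by apply: addchar_eq => s /=; rewrite mulrA. Qed.
Lemma addchar1Z : left_id 1 addcharZ.
Proof. by move=> u; apply: addchar_eq => s /=; rewrite mul1r. Qed.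
Lemma addcharZDr : right_distributive addcharZ +%R.
Proof. by move=> a u v; apply: addchar_eq => s /=; rewrite mulrDr. Qed.
Lemma addcharZDl u : {morph addcharZ^~ u : a b / a + b}.
Proof. by move=> a b; apply: addchar_eq => s /=; rewrite mulrDl. Qed.
HB.instance Definition _ := GRing.Zmodule_isLmodule.Build k (addchar k G)
  addcharZA addchar1Z addcharZDr addcharZDl.

End AddChar.

Record derivation (k : fieldType) (B : kcat k) := Derivation {
  der_fun :> forall b c : ob B, khom b c -> khom b c;
  der_linear : forall b c, linear (@der_fun b c);
  der_leibniz : forall b c d (g : khom c d) (f : khom b c),
    der_fun (cmp g f) = cmp g (der_fun f) + cmp (der_fun g) f }.

HB.instance Definition _ k B := gen_eqMixin (@derivation k B).
HB.instance Definition _ k B := gen_choiceMixin (@derivation k B).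

Local Open Scope quotient_scope.

Section Hochschild.
Variables (k : fieldType) (B : kcat k).
Implicit Types D E : derivation B.

Lemma derivation_eq D E :
  (forall b c (f : khom b c), D b c f = E b c f) -> D = E.
Proof.
case: D E => D Dl DM [E El EM] /= DE.
have e : D = E.
  apply: functional_extensionality_dep => b.
  apply: functional_extensionality_dep => c.
  by apply: functional_extensionality_dep => f.
clear DE; case: E / e El EM => El EM.
by congr Derivation; exact: Prop_irrelevance.
Qed.

Lemma der0_linear (b c : ob B) : linear (fun _ : khom b c => 0 : khom b c).
Proof. by move=> a f g; rewrite scaler0 addr0. Qed.
Lemma der0_leibniz (b c d : ob B) (g : khom c d) (f : khom b c) :
  0 = cmp g (0 : khom b c) + cmp (0 : khom c d) f.
Proof. by rewrite cmpm0 cmp0m addr0. Qed.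
Definition der0 : derivation B := Derivation der0_linear der0_leibniz.

Lemma derN_linear D (b c : ob B) : linear (fun f : khom b c => - D b c f).
Proof. by move=> a f g; rewrite der_linear opprD scalerN. Qed.
Lemma derN_leibniz D (b c d : ob B) (g : khom c d) (f : khom b c) :
  - D b d (cmp g f) = cmp g (- D b c f) + cmp (- D c d g) f.
Proof. by rewrite der_leibniz opprD cmpNr cmpNl. Qed.
Definition derN D : derivation B := Derivation (derN_linear D) (derN_leibniz D).

Lemma derD_linear D E (b c : ob B) :
  linear (fun f : khom b c => D b c f + E b c f).
Proof. by move=> a f g; rewrite !der_linear scalerDr addrACA. Qed.
Lemma derD_leibniz D E (b c d : ob B) (g : khom c d) (f : khom b c) :
  D b d (cmp g f) + E b d (cmp g f) =
  cmp g (D b c f + E b c f) + cmp (D c d g + E c d g) f.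
Proof. by rewrite !der_leibniz cmpDr cmpDl addrACA. Qed.
Definition derD D E : derivation B :=
  Derivation (derD_linear D E) (derD_leibniz D E).

Lemma derZ_linear a D (b c : ob B) : linear (fun f : khom b c => a *: D b c f).
Proof. by move=> l f g; rewrite der_linear scalerDr !scalerA mulrC. Qed.
Lemma derZ_leibniz a D (b c d : ob B) (g : khom c d) (f : khom b c) :
  a *: D b d (cmp g f) = cmp g (a *: D b c f) + cmp (a *: D c d g) f.
Proof. by rewrite der_leibniz scalerDr cmpZr cmpZl. Qed.
Definition derZ a D : derivation B :=
  Derivation (derZ_linear a D) (derZ_leibniz a D).

Lemma derDA : associative derD.
Proof. by move=> D E F; apply: derivation_eq => b c f /=; rewrite addrA. Qed.
Lemma derDC : commutative derD.
Proof. by move=> D E; apply: derivation_eq => b c f /=; rewrite addrC. Qed.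
Lemma der0D : left_id der0 derD.
Proof. by move=> D; apply: derivation_eq => b c f /=; rewrite add0r. Qed.
Lemma derND : left_inverse der0 derN derD.
Proof. by move=> D; apply: derivation_eq => b c f /=; rewrite addNr. Qed.
HB.instance Definition _ := GRing.isZmodule.Build (derivation B)
  derDA derDC der0D derND.

Lemma derZA a l D : derZ a (derZ l D) = derZ (a * l) D.
Proof. by apply: derivation_eq => b c f /=; rewrite scalerA. Qed.
Lemma der1Z : left_id 1 derZ.
Proof. by move=> D; apply: derivation_eq => b c f /=; rewrite scale1r. Qed.
Lemma derZDr : right_distributive derZ +%R.
Proof. by move=> a D E; apply: derivation_eq => b c f /=; rewrite scalerDr. Qed.
Lemma derZDl D : {morph derZ^~ D : a l / a + l}.
Proof. by move=> a l; apply: derivation_eq => b c f /=; rewrite scalerDl. Qed.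
HB.instance Definition _ := GRing.Zmodule_isLmodule.Build k (derivation B)
  derZA der1Z derZDr derZDl.

Definition is_inner D := exists alpha : forall b : ob B, khom b b,
  forall b c (f : khom b c), D b c f = cmp (alpha c) f - cmp f (alpha b).

Definition inner_derivations : {pred derivation B} :=
  [pred D | `[< is_inner D >]].

Lemma inner_submod_closed : submod_closed inner_derivations.
Proof.
split=> [|a D E]; rewrite !inE.
  exists (fun b => 0); move=> b c f.
  by rewrite cmp0m cmpm0 subr0.
move=> [al Dal] [be Ebe].
exists (fun b => a *: al b + be b); move=> b c f.
rewrite [LHS]/(a *: D b c f + E b c f) Dal Ebe cmpDl cmpDr cmpZl cmpZr.
by rewrite scalerBr opprD addrACA.
Qed.

HB.instance Definition _ :=
  GRing.isSubmodClosed.Build k (derivation B) inner_derivations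
    (GRing.submod_closed_semi inner_submod_closed).

Definition HH1 := Quotient.quot inner_derivations.
HB.instance Definition _ := ZmodQuotient.on HH1.

Definition HH1_class D : HH1 := \pi_HH1 D.

Lemma HH1_classP D E : HH1_class D = HH1_class E <-> is_inner (D - E).
Proof.
split; last first.
  by move=> /asboolP h; apply/eqP; rewrite -Quotient.idealrBE.
by move=> /eqP; rewrite -Quotient.idealrBE => /asboolP.
Qed.

Lemma HH1_reprK (x : HH1) : HH1_class (repr x) = x.
Proof. exact: reprK. Qed.

Definition HH1_scale a (x : HH1) : HH1 := HH1_class (a *: repr x).

Lemma HH1_scaleE a D : HH1_scale a (HH1_class D) = HH1_class (a *: D).
Proof.
apply/eqP; rewrite -Quotient.idealrBE -scalerBr rpredZ //.
by rewrite Quotient.idealrBE reprK.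
Qed.

Lemma HH1_addE D E : HH1_class D + HH1_class E = HH1_class (D + E).
Proof. by rewrite /HH1_class -raddfD. Qed.

Lemma HH1_scaleA a l x : HH1_scale a (HH1_scale l x) = HH1_scale (a * l) x.
Proof. by rewrite -[x]HH1_reprK !HH1_scaleE scalerA. Qed.
Lemma HH1_scale1 : left_id 1 HH1_scale.
Proof. by move=> x; rewrite -[x]HH1_reprK HH1_scaleE scale1r. Qed.
Lemma HH1_scaleDr : right_distributive HH1_scale +%R.
Proof.
move=> a x y; rewrite -[x]HH1_reprK -[y]HH1_reprK HH1_addE !HH1_scaleE HH1_addE.
by rewrite scalerDr.
Qed.
Lemma HH1_scaleDl x : {morph HH1_scale^~ x : a l / a + l}.
Proof. by move=> a l; rewrite -[x]HH1_reprK !HH1_scaleE HH1_addE scalerDl. Qed.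
HB.instance Definition _ := GRing.Zmodule_isLmodule.Build k HH1
  HH1_scaleA HH1_scale1 HH1_scaleDr HH1_scaleDl.

Lemma HH1_class_linear : linear HH1_class.
Proof.
by move=> a D E; rewrite -HH1_addE -HH1_scaleE.
Qed.
HB.instance Definition _ :=
  GRing.isLinear.Build k (derivation B) HH1 _ HH1_class HH1_class_linear.

End Hochschild.

(* Main.v *)
Require Import Defs.
From HB Require Import structures.
From mathcomp Require Import all_boot all_algebra.
From mathcomp Require Import boolp classical_sets functions cardinality fsbigop.

Set Implicit Arguments.
Unset Strict Implicit.
Unset Printing Implicit Defensive.

Import GRing.Theory.
Local Open Scope ring_scope.

(** For f : y -> z in C, a function p on the objects of C multiplies F f by
    p z - p y. If p changes under each automorphism s of F by a constant psi s,
    this rule is the same for f and s f, so it descends along the covering to a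
    derivation of B ([scales_exists]). On C itself the rule is the inner derivation
    of the family p y 1_y, but on B it need not be inner. Each character psi comes
    from such a potential p, normalised to vanish at chosen base points
    x_b, because the automorphisms act simply transitively on the fibres
    ([aut1_free], [aut1_transitive], [potential_exists]). On the image under F of
    the morphisms from x_b to s x_c, the derivation is then multiplication by
    psi s, which is the rule that defines the canonical map.

    Say that a derivation realizes psi if it comes from some potential for psi.
    Realization is linear, and the two lemmas that carry the theorem compute its
    kernel in both directions. A derivation that realizes 0 is inner
    ([realizes0_inner]): its potential is constant on the fibres, hence is
    pulled back from the objects of B. So the class of a derivation depends only
    on the character it realizes, which gives at once the linearity of Delta and
    its independence of the base points. Conversely, if an inner derivation
    realizes psi, then psi = 0 ([inner_realizes0]): endomorphisms being scalars,
    alpha_b = a_b 1_b, and p - a \o F takes the same value at both ends of every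
    nonzero morphism of C, so it is constant as C is connected, and therefore p
    is constant on the fibres.

    Simple transitivity on the fibres rests on unique lifting. For x over b, the
    star isomorphism writes each morphism f of B out of b as a sum of images of
    morphisms out of x ([fibre_map_span]) and recovers these from f
    ([fibre_lift]). The same facts for morphisms into x follow by passing to
    opposite categories. *)

(** * Linear maps, connected categories and functors *)

Lemma linear_pack (k : fieldType) (U V : lmodType k) (f : U -> V) :
  linear f -> exists g : {linear U -> V}, g =1 f.
Proof.
move=> lf; pose m := GRing.isLinear.Build k U V *:%R f lf.
by exists (HB.pack_for {linear U -> V} f m).
Qed.

(** The connectedness of the total category enters only through this induction
    along nonzero morphisms. *)
Lemma kconnected_ind (k : fieldType) (C : kcat k) (P : ob C -> Prop) x :
  kconnected C ->
  (forall y z, adjacent y z -> P y -> P z) -> P x -> forall y, P y.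
Proof.
move=> connC Padj Px y; have [n [p [p0 <- padj]]] := connC x y.
have : forall i, (i <= n)%N -> P (p i); last by move=> /(_ n (leqnn n)).
elim=> [_|i IHi ltin]; first by rewrite p0.
exact: Padj (padj i ltin) (IHi (ltnW ltin)).
Qed.

Lemma kfunctor_eq_id (k : fieldType) (C : kcat k) (H : kfunctor C C)
    (e : forall x, H x = x) :
  (forall x y (f : khom x y), hcast (e x) (e y) (fmap H f) = f) -> H = fid C.
Proof.
case: H e => h m ml m1 mc /= e; have /funext eh : h =1 id := e.
rewrite /= in eh.
move: m ml m1 mc e; rewrite eh => m ml m1 mc e em.
apply: (@kfunctor_eq _ _ _ (KFunctor ml m1 mc) (fid C) erefl) => /=.
apply: functional_extensionality_dep => x.
apply: functional_extensionality_dep => y.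
apply: functional_extensionality_dep => f.
rewrite -[RHS]em (Prop_irrelevance (e x) erefl).
by rewrite (Prop_irrelevance (e y) erefl).
Qed.

(** * The action of a functor on morphisms between fibres *)

Section FibreMap.
Variables (k : fieldType) (C B : kcat k) (F : kfunctor C B).

Lemma fibre_mapE b c x y (ex : F x = b) (ey : F y = c) (f : khom x y) :
  @fibre_map k C B F b c (exist _ x ex) (exist _ y ey) f =
  hcast ex ey (fmap F f).
Proof.
by rewrite /fibre_map /=; congr hcast; exact: Prop_irrelevance.
Qed.

Lemma fibre_map_linear b c (x : fibre F b) (y : fibre F c) :
  linear (@fibre_map k C B F b c x y).
Proof.
case: x y => x ex [y ey] a f g; rewrite !fibre_mapE.
by destruct ex, ey; exact: fmap_linear.
Qed.

HB.instance Definition _ b c (x : fibre F b) (y : fibre F c) :=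
  GRing.isLinear.Build k (khom (sval x) (sval y)) (khom b c) _
    (@fibre_map k C B F b c x y) (@fibre_map_linear b c x y).

Lemma fibre_map_cmp b c d (x : fibre F b) (y : fibre F c) (z : fibre F d)
    (g : khom (sval y) (sval z)) (f : khom (sval x) (sval y)) :
  fibre_map (cmp g f) = cmp (fibre_map g) (fibre_map f).
Proof.
case: x y z g f => x ex [y ey] [z ez] /= g f; rewrite !fibre_mapE.
by destruct ex, ey, ez; exact: fmap_cmp.
Qed.

(** This is F s = F on morphisms; the transports to khom b c absorb the change
    of the objects F (s x), F (s y) into F x, F y. *)
Lemma fibre_map_aut1 (s : aut1 F) b c (x : fibre F b) (y : fibre F c)
    (f : khom (sval x) (sval y)) :
  @fibre_map k C B F b c (aut1_act s x) (aut1_act s y) (fmap s f) =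
  fibre_map f.
Proof.
case: x y f => x ex [y ey] /= f; rewrite !fibre_mapE.
move: (etrans _ _) (etrans _ _) => /= esy esx.
have sF : hcast esx esy (fmap (fcomp F s) f) = hcast ex ey (fmap F f).
  move: esx esy; rewrite -[F (s x)]/(fcomp F s x) -[F (s y)]/(fcomp F s y).
  rewrite aut1_over => esx esy.
  by congr hcast; exact: Prop_irrelevance.
exact: sF.
Qed.

(** Lets a lift be re-based along an equality of objects of C, for instance
    s x = x', without rewriting inside dependent types. *)
Lemma fibre_map_hcast b c (x x' : fibre F b) (y y' : fibre F c)
    (ex : sval x = sval x') (ey : sval y = sval y')
    (f : khom (sval x) (sval y)) :
  @fibre_map k C B F b c x' y' (hcast ex ey f) = fibre_map f.
Proof.
case: x x' y y' ex ey f => x fx [x' fx'] [y fy] [y' fy'] /= ex ey f.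
rewrite !fibre_mapE; destruct ex, ey.
by congr hcast; exact: Prop_irrelevance.
Qed.

End FibreMap.

(** * Opposite categories *)

Section Opposite.
Variable k : fieldType.

Program Definition op_kcat (B : kcat k) : kcat k :=
  @KCat k (ob B) (fun x y => khom y x) (fun x y => hom_lmod y x) idm
    (fun x y z g f => cmp f g) _ _ _ _ _.
Next Obligation. by move=> a f f'; exact: (cmp_linearl g a f f'). Qed.
Next Obligation. by move=> a g g'; exact: (cmp_linearr f a g g'). Qed.
Next Obligation. by rewrite cmpA. Qed.
Next Obligation. by rewrite cmpm1. Qed.
Next Obligation. by rewrite cmp1m. Qed.

Program Definition op_kfunctor (C B : kcat k) (F : kfunctor C B) :
    kfunctor (op_kcat C) (op_kcat B) :=
  @KFunctor k (op_kcat C) (op_kcat B) (fob F) (fun x y => @fmap k C B F y x)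
    _ _ _.
Next Obligation. by move=> a f g; exact: (@fmap_linear k C B F y x a f g). Qed.
Next Obligation. exact: fmap1. Qed.
Next Obligation. exact: fmap_cmp. Qed.

Lemma op_kfunctor_comp (C D E : kcat k) (G : kfunctor D E) (F : kfunctor C D) :
  op_kfunctor (fcomp G F) = fcomp (op_kfunctor G) (op_kfunctor F).
Proof.
exact: (@kfunctor_eq k _ _ (op_kfunctor (fcomp G F))
  (fcomp (op_kfunctor G) (op_kfunctor F)) erefl).
Qed.

Lemma op_kfunctor_id (C : kcat k) : op_kfunctor (fid C) = fid (op_kcat C).
Proof.
exact: (@kfunctor_eq k _ _ (op_kfunctor (fid C)) (fid (op_kcat C)) erefl).
Qed.

Variables (C B : kcat k) (F : kfunctor C B).

(** Passing to opposites exchanges the two summands of every star. *)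
Lemma op_covering : is_covering F -> is_covering (op_kfunctor F).
Proof.
move=> [surjF bijF]; split=> // x; have [g Kg gK] := bijF x.
pose swap (U V : Type) (u : U * V) := (u.2, u.1).
exists (fun v => swap _ _ (g (swap _ _ v))) => [[u v]|[u v]].
  by rewrite /swap; have := Kg (v, u); rewrite /star_map /= => ->.
move: (gK (v, u)); rewrite /swap /=.
case: (g (v, u)) => /= a b; rewrite /star_map /= => -[e e'].
by congr pair.
Qed.

Definition op_aut1 (s : aut1 F) : aut1 (op_kfunctor F).
Proof.
refine (@Aut1 k _ _ _ (op_kfunctor s) (op_kfunctor (aut1_inv s)) _ _ _).
- by rewrite -op_kfunctor_comp aut1_invK op_kfunctor_id.
- by rewrite -op_kfunctor_comp aut1_funK op_kfunctor_id.
by rewrite -op_kfunctor_comp aut1_over.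
Defined.

Lemma op_fibre_map b c (x : fibre F b) (y : fibre F c)
    (f : khom (sval x) (sval y)) :
  @fibre_map k _ _ (op_kfunctor F) c b y x f = fibre_map f.
Proof.
case: x y f => x ex [y ey] /= f.
rewrite (@fibre_mapE k _ _ (op_kfunctor F) c b y x ey ex f) fibre_mapE.
by destruct ex, ey.
Qed.

End Opposite.

(** * Lifting morphisms along a covering *)

Section StarLift.
Variables (k : fieldType) (C B : kcat k) (F : kfunctor C B).
Hypothesis covF : is_covering F.

Local Notation hom_from x := (fun y => khom x y : lmodType k).

(** The first component of the inverse of the star map, restricted to one
    summand of the outgoing star. *)
Lemma star_lift (x : ob C) :
  exists lift : forall c : ob B, {linear khom (F x) c -> star_out x},
    (forall y (g : khom x y),
       lift (F y) (fmap F g) = @dinj k (ob C) (hom_from x) y g) /\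
    forall c (f : khom (F x) c),
      @dlift k (ob C) (hom_from x) _
        (fun y => @fmap_out k C B F x y : {linear _ -> _}) (lift c f) =
      @dinj k (ob B) (hom_from (F x)) c f.
Proof.
have [g Kg gK] := covF.2 x.
have lg : linear g := can2_linear Kg gK.
pose incl c (f : khom (F x) c) : star_out x :=
  (g (@dinj k (ob B) (hom_from (F x)) c f, 0)).1.
have lincl c : linear (@incl c).
  move=> a f h; rewrite /incl -(linearP (fst : {linear star x -> star_out x})).
  rewrite -lg; congr (g _).1; congr pair; first exact: dinj_linear.
  by rewrite /= scaler0 addr0.
pose lift c := sval (cid (linear_pack (@lincl c))).
have liftE c : lift c =1 @incl c by exact: (svalP (cid (linear_pack _))).
exists lift; split=> [y f|c f]; rewrite liftE /incl.
  by rewrite -[LHS]/(g (fmap_out F f, 0)).1 -star_map_out Kg.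
exact: (congr1 fst (gK (@dinj k (ob B) (hom_from (F x)) c f, 0))).
Qed.

(** Surjectivity of the star map, as an induction principle: additive statements
    about morphisms out of b need to be checked only on images of morphisms out
    of one chosen x over b. *)
Lemma fibre_map_span b c (x : fibre F b) (P : khom b c -> Prop) :
  P 0 -> (forall f g, P f -> P g -> P (f + g)) ->
  (forall (y : fibre F c) (g : khom (sval x) (sval y)), P (fibre_map g)) ->
  forall f, P f.
Proof.
case: x => x ex; destruct ex => P0 PD Pmap f.
have [lift [_ liftK]] := star_lift x.
pose out := star_out (F x).
pose Q (v : out) := P (dval v c).
have Q0 : Q 0 by exact: P0.
have QD (u v : out) : Q u -> Q v -> Q (u + v) by exact: PD.
have Qmap y (g : khom x y) : Q (fmap_out F g).
  rewrite /Q /= /single; case: pselect => //= e.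
  by have := Pmap (exist _ y e) g; rewrite fibre_mapE.
suff : Q (@dinj k (ob B) (hom_from (F x)) c f) by rewrite /Q /= single_id.
rewrite -liftK (dliftE _ (dfin (lift c f))) // fsbig_finite; last exact: dfin.
by elim/big_ind: _ => // y _; exact: Qmap.
Qed.

(** Injectivity of the star map, in the form of a linear map that recovers a
    morphism out of x, together with its target, from its image. *)
Lemma fibre_lift b (x : fibre F b) :
  exists lift : forall c : ob B, {linear khom b c -> star_out (sval x)},
    forall c (y : fibre F c) (g : khom (sval x) (sval y)),
      lift c (fibre_map g) = @dinj k (ob C) (hom_from (sval x)) (sval y) g.
Proof.
case: x => x ex; destruct ex; have [lift [liftE _]] := star_lift x.
exists lift => c [y ey] g; destruct ey.
by rewrite fibre_mapE; exact: liftE.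
Qed.

Lemma fibre_map_inj b c (x : fibre F b) (y : fibre F c) :
  injective (@fibre_map k C B F b c x y).
Proof.
have [lift liftE] := fibre_lift x; move=> f g /(congr1 (lift c)).
rewrite !liftE => /(congr1 (fun u : star_out _ => dval u (sval y))) /=.
by rewrite !single_id.
Qed.

(** Two lifts of the same morphism with distinct targets lie in distinct summands
    of the outgoing star, so they would both vanish. *)
Lemma lift_end_unique b c (x : fibre F b) (y z : fibre F c)
    (g : khom (sval x) (sval y)) (h : khom (sval x) (sval z)) :
  fibre_map g = fibre_map h -> g != 0 -> sval y = sval z.
Proof.
have [lift liftE] := fibre_lift x; move=> /(congr1 (lift c)).
rewrite !liftE => /(congr1 (fun u : star_out _ => dval u (sval y))) /=.
rewrite single_id /single; case: pselect => [e _ _|_ ->]; last by rewrite eqxx.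
exact: esym e.
Qed.

(** The morphisms g and s g have the same image and, as s fixes x, the same
    source; a nonzero morphism has only one lift from x. *)
Lemma aut1_fix_target (s : aut1 F) x y (g : khom x y) :
  g != 0 -> s x = x -> s y = y.
Proof.
move=> g0 sx; pose x' : fibre F (F x) := exist _ x erefl.
pose y' : fibre F (F y) := exist _ y erefl.
have := @fibre_map_aut1 k C B F s _ _ x' y' g.
rewrite -(@fibre_map_hcast k C B F _ _ (aut1_act s x') x' _
  (aut1_act s y') sx erefl) => /esym/lift_end_unique.
by move=> /(_ g0)/esym.
Qed.

End StarLift.

Section Cospan.
Variables (k : fieldType) (C B : kcat k) (F : kfunctor C B).
Hypothesis covF : is_covering F.

Lemma fibre_map_cospan b c (y : fibre F c) (P : khom b c -> Prop) :
  P 0 -> (forall f g, P f -> P g -> P (f + g)) ->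
  (forall (x : fibre F b) (g : khom (sval x) (sval y)), P (fibre_map g)) ->
  forall f, P f.
Proof.
move=> P0 PD Pmap.
apply: (@fibre_map_span _ _ _ _ (op_covering covF) c b y P P0 PD) => x g.
by rewrite op_fibre_map; exact: Pmap.
Qed.

(** Transitivity on the fibre of x spreads to the fibre of y along a nonzero
    g : x -> y. Lift F g at y1: it is a sum of images of morphisms h into y1,
    with sources over F x. Moved by a_i to start at x, each h ends at a_i y1. If
    no a_i y1 were y, the component at y of the lift of F g from x would be zero,
    but this component is g. A family a is used, instead of all automorphisms, so
    that the statement transfers to opposite categories. *)
Lemma orbit_target (I : Type) (a : I -> aut1 F) x y (g : khom x y) :
    g != 0 -> (forall x1, F x1 = F x -> exists i, a i x1 = x) ->
  forall y1, F y1 = F y -> exists i, a i y1 = y.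
Proof.
move=> g0 orbx y1 ey1; apply: contrapT => norb.
(* The component at y of the lift from x vanishes on all of khom (F x) (F y),
   although it sends F g to g. *)
have [lift liftE] := fibre_lift covF (exist _ x erefl : fibre F (F x)).
have lift0 (f : khom (F x) (F y)) : dval (lift _ f) y = 0.
  move: f; apply: (fibre_map_cospan (y := exist _ y1 ey1)).
  - by rewrite linear0.
  - by move=> f h; rewrite linearD /= => -> ->; rewrite addr0.
  move=> [x1 ex1] h /=; have [i ax1] := orbx x1 ex1.
  rewrite -(fibre_map_aut1 (a i)).
  rewrite -(@fibre_map_hcast _ _ _ _ _ _ (aut1_act (a i) (exist _ x1 ex1))
    (exist _ x erefl) _ (aut1_act (a i) (exist _ y1 ey1)) ax1 erefl).
  rewrite liftE /= /single.
  by case: pselect => // e; case: norb; exists i.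
have := lift0 (fmap F g).
rewrite -[fmap F g](fibre_mapE (x := x) (y := y) erefl erefl) liftE /=.
by rewrite single_id => ge0; rewrite ge0 eqxx in g0.
Qed.

End Cospan.

(** * Automorphisms of a covering with connected source *)

Section Galois.
Variables (k : fieldType) (C B : kcat k) (F : kfunctor C B).
Hypotheses (covF : is_covering F) (connC : kconnected C).

Lemma aut1_fix_adjacent (s : aut1 F) x y : adjacent x y -> s x = x -> s y = y.
Proof.
case=> -[g g0]; first exact: (aut1_fix_target covF g0).
exact: (@aut1_fix_target _ _ _ _ (op_covering covF) (op_aut1 s) x y g g0).
Qed.

Lemma orbit_adjacent (I : Type) (a : I -> aut1 F) x y : adjacent x y ->
    (forall x1, F x1 = F x -> exists i, a i x1 = x) ->
  forall y1, F y1 = F y -> exists i, a i y1 = y.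
Proof.
case=> -[g g0]; first exact: (orbit_target covF g0).
exact: (@orbit_target _ _ _ _ (op_covering covF) I (fun i => op_aut1 (a i))
  x y g g0).
Qed.

(** By connectedness s fixes every object; a morphism and its image under s then
    have the same ends and the same image under F, which is faithful. *)
Lemma aut1_fix_eq1 (s : aut1 F) x : s x = x -> s = 1%g.
Proof.
move=> sx; have e : forall y, s y = y.
  exact: kconnected_ind connC (aut1_fix_adjacent (s := s)) sx.
apply: aut1_eq; apply: (@kfunctor_eq_id _ _ _ e) => y z f.
pose y' : fibre F (F y) := exist _ y erefl.
pose z' : fibre F (F z) := exist _ z erefl.
apply: (@fibre_map_inj _ _ _ _ covF _ _ y' z').
rewrite (@fibre_map_hcast _ _ _ _ _ _ (aut1_act s y') _ (aut1_act s z')).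
exact: (@fibre_map_aut1 _ _ _ _ _ _ _ y' z').
Qed.

Lemma aut1_free (s t : aut1 F) x : s x = t x -> s = t.
Proof.
move=> stx; suff e : (t^-1 * s = 1)%g.
  by rewrite -[s]mul1g -(mulgV t) -mulgA e mulg1.
apply: (@aut1_fix_eq1 _ x).
rewrite -[LHS]/(aut1_inv t (s x)) stx -[LHS]/(fcomp (aut1_inv t) t x).
by rewrite aut1_invK.
Qed.

End Galois.

(** * Derivations defined by potentials *)

Section Potentials.
Variables (k : fieldType) (C B : kcat k) (F : kfunctor C B).

Definition potential (psi : aut1 F -> k) (p : ob C -> k) :=
  forall (s : aut1 F) y, p (s y) = psi s + p y.

Definition scales (D : forall b c : ob B, khom b c -> khom b c)
    (p : ob C -> k) :=
  forall b c (x : fibre F b) (y : fibre F c) (g : khom (sval x) (sval y)),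
    D b c (fibre_map g) = (p (sval y) - p (sval x)) *: fibre_map g.

Definition realizes (D : derivation B) (psi : aut1 F -> k) :=
  exists2 p, potential psi p & scales D p.

Lemma realizes_linear a D E psi phi : realizes D psi -> realizes E phi ->
  realizes (a *: D + E) (fun s => a * psi s + phi s).
Proof.
move=> [p pp Dp] [q qq Eq]; exists (fun y => a * p y + q y) => [s y|b c x y g].
  by rewrite pp qq mulrDr addrACA.
rewrite -[LHS]/(a *: D b c _ + E b c _) Dp Eq scalerA -scalerDl.
by congr (_ *: _); rewrite mulrBr opprD addrACA.
Qed.

Hypothesis galF : galois_covering F.

Let covF : is_covering F. Proof. by case: galF. Qed.
Let connC : kconnected C. Proof. by case: galF. Qed.

(** Transitivity, which a Galois covering has on one fibre by definition, holds
    on every fibre. *)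
Lemma aut1_transitive x y : F x = F y -> exists s : aut1 F, s x = y.
Proof.
have [_ _ [b trb]] := galF; have [z ez] := covF.1 b.
move: x; apply: (kconnected_ind connC (P := fun y =>
  forall x, F x = F y -> exists s : aut1 F, s x = y) (x := z)) => [u v uv|x].
  exact: (orbit_adjacent covF (a := fun s => s) uv).
rewrite ez => ex.
have [s /(congr1 sval) sx] := trb (exist _ x ex) (exist _ z ez).
by exists s.
Qed.

(** Outgoing lifts from a single x over b define the scaling map. It satisfies
    the same formula for any other lift x1, because some s carries x1 to x and
    p z - p y is invariant under automorphisms. *)
Lemma scaling_exists psi p : potential psi p -> forall b c : ob B,
  exists d : {linear khom b c -> khom b c},
    forall (x : fibre F b) (y : fibre F c) (g : khom (sval x) (sval y)),
      d (fibre_map g) = (p (sval y) - p (sval x)) *: fibre_map g.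
Proof.
move=> pp b c; have [x ex] := covF.1 b; destruct ex.
have [lift [liftE _]] := star_lift covF x.
pose h y : {linear khom x y -> star_out (F x)} :=
  (p y - p x) \*: (@fmap_out k C B F x y : {linear _ -> _}).
pose d f : khom (F x) c :=
  dval (@dlift k (ob C) (fun y => khom x y : lmodType k) _ h (lift c f)) c.
have ld : linear d by move=> a f g; rewrite /d !linearP.
have [d' d'E] := linear_pack ld.
pose x0 : fibre F (F x) := exist _ x erefl.
have d'x0 (y : fibre F c) (g : khom (sval x0) (sval y)) :
    d' (fibre_map g) = (p (sval y) - p x) *: fibre_map g.
  case: y g => y ey /= g; rewrite d'E fibre_mapE /d; destruct ey.
  by rewrite liftE dlift_dinj /= single_id.
exists d' => x1 y g.
have [s sx1] := aut1_transitive (svalP x1 : F (sval x1) = F x).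
rewrite -(fibre_map_aut1 s).
rewrite -(@fibre_map_hcast _ _ _ _ _ _ (aut1_act s x1) x0 _ (aut1_act s y)
  sx1 erefl) d'x0 /=.
have -> : p x = psi s + p (sval x1) by rewrite -pp; congr p.
by rewrite pp opprD addrACA subrr add0r.
Qed.

(** After f is lifted to end at some y and g to start at the same y, the Leibniz
    rule says that p z - p x = (p y - p x) + (p z - p y). *)
Lemma scales_exists psi p : potential psi p ->
  exists D : derivation B, scales D p.
Proof.
move=> pp; pose d b c := sval (cid (scaling_exists pp b c)).
have dE b c (x : fibre F b) (y : fibre F c) (g : khom (sval x) (sval y)) :
    d b c (fibre_map g) = (p (sval y) - p (sval x)) *: fibre_map g.
  exact: (svalP (cid (scaling_exists pp b c))).
have d_leibniz b c e (g : khom c e) (f : khom b c) :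
    d b e (cmp g f) = cmp g (d b c f) + cmp (d c e g) f.
  have [x ex] := covF.1 b; pose x' : fibre F b := exist _ x ex.
  move: f; apply: (fibre_map_span covF (x := x')) => [|f f' IHf IHf'|y f].
  - by rewrite linear0 !cmpm0 linear0 addr0.
  - by rewrite linearD !cmpDr linearD /= IHf IHf' addrACA.
  move: g; apply: (fibre_map_span covF (x := y)) => [|g g' IHg IHg'|z g].
  - by rewrite linear0 !cmp0m linear0 addr0.
  - by rewrite linearD !cmpDl linearD /= IHg IHg' addrACA.
  rewrite -fibre_map_cmp !dE fibre_map_cmp cmpZr cmpZl -scalerDl.
  by congr (_ *: _); rewrite [RHS]addrC addrA subrK.
by exists (Derivation (fun b c => linearP (d b c)) d_leibniz).
Qed.

(** The value at y is psi s, where s is the only automorphism that takes to y the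
    base point of the fibre of y. *)
Lemma potential_exists (psi : addchar k (aut1 F)) (x : forall b, fibre F b) :
  exists2 p, potential psi p & forall b, p (sval (x b)) = 0.
Proof.
have trx y : exists s : aut1 F, s (sval (x (F y))) = y.
  exact: (aut1_transitive (svalP (x (F y)))).
pose t y := sval (cid (trx y)).
have tE y : t y (sval (x (F y))) = y by exact: (svalP (cid (trx y))).
have eqt (s : aut1 F) y z : s (sval (x (F z))) = y -> t y = s.
  move=> sy; have ey : F y = F z by rewrite -sy aut1_ob (svalP (x (F z))).
  apply: (aut1_free covF connC (x := sval (x (F z)))).
  by rewrite sy; have := tE y; rewrite ey.
exists (fun y => psi (t y)) => [s y|b].
  by rewrite -addcharM (eqt (s * t y)%g _ y) //=; rewrite tE.
have [z zb] := covF.1 b; rewrite -zb.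
rewrite (eqt 1%g _ z) //.
by have := addcharM psi 1 1; rewrite mulg1 -{1}[psi 1%g]addr0 => /addrI/esym.
Qed.

Lemma scales_homogeneous D psi p (x : forall b, fibre F b) :
    potential psi p -> (forall b, p (sval (x b)) = 0) -> scales D p ->
  forall (s : aut1 F) b c (f : khom b c),
    homogeneous x s f -> D b c f = psi s *: f.
Proof.
move=> pp px Dp s b c f [g _ <-].
by rewrite Dp /= pp !px addr0 subr0.
Qed.

(** The potential is invariant under automorphisms, hence descends to a function
    q on the objects of B, and alpha_b = q b 1_b. *)
Lemma realizes0_inner D psi : realizes D psi -> psi =1 (fun=> 0) -> is_inner D.
Proof.
move=> [p pp Dp] psi0.
have p_fibre y z : F y = F z -> p y = p z.
  by move=> /aut1_transitive[s <-]; rewrite pp psi0 add0r.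
pose q b := p (sval (cid (covF.1 b))).
have qE b (x : fibre F b) : q b = p (sval x).
  by apply: p_fibre; rewrite (svalP (cid (covF.1 b))) (svalP x).
exists (fun b => q b *: idm b) => b c f.
have [x ex] := covF.1 b; pose x' : fibre F b := exist _ x ex.
have [d dE] := linear_pack (@der_linear _ _ D b c).
rewrite cmpZl cmpZr cmp1m cmpm1 -scalerBl -dE.
move: f; apply: (fibre_map_span covF (x := x')) => [|f f'|y f].
- by rewrite linear0 scaler0.
- by rewrite linearD scalerDr /= => -> ->.
by rewrite dE Dp (qE c y) (qE b x').
Qed.

(** With alpha_b = a_b 1_b, a nonzero g : y -> z satisfies
    p z - p y = a (F z) - a (F y), so p - a \o F is constant on C; comparing its
    values at s x and x, which lie in the same fibre, gives psi s = 0. *)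
Lemma inner_realizes0 D psi : (forall b : ob B, end_reduced b) -> ob C ->
  realizes D psi -> is_inner D -> psi =1 (fun=> 0).
Proof.
move=> endB x [p pp Dp] [alpha Dalpha] s.
have aE b : exists a, alpha b = a *: idm b.
  by have [g _ gK] := endB b; exists (g (alpha b)).
pose a b := sval (cid (aE b)).
have alphaE b : alpha b = a b *: idm b by exact: (svalP (cid (aE b))).
have edge y z (g : khom y z) : g != 0 -> p z - a (F z) = p y - a (F y).
  move=> g0; pose y' : fibre F (F y) := exist _ y erefl.
  pose z' : fibre F (F z) := exist _ z erefl.
  pose f := @fibre_map _ _ _ F _ _ y' z' g.
  have f0 : f != 0.
    apply: contra g0 => /eqP f0; apply/eqP.
    by apply: (@fibre_map_inj _ _ _ _ covF _ _ y' z'); rewrite linear0.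
  have := Dp _ _ y' z' g.
  rewrite Dalpha !alphaE cmpZl cmpZr cmp1m cmpm1 -scalerBl.
  move=> /eqP; rewrite -subr_eq0 -scalerBl scaler_eq0 (negPf f0) orbF subr_eq0.
  move=> /eqP /= e; have -> : p z = a (F z) - a (F y) + p y by rewrite e subrK.
  by rewrite addrC !addrA addNr add0r addrC.
have const y : p y - a (F y) = p x - a (F x).
  move: y; apply: (kconnected_ind connC (x := x)) => // y z yz <-.
  by case: yz => -[g g0]; rewrite (edge _ _ g g0).
have := const (s x); rewrite aut1_ob pp => /addIr /eqP.
by rewrite -subr_eq0 addrK => /eqP.
Qed.

End Potentials.

(** * The canonical map from characters to cohomology *)

Theorem corollary5p11 (k : fieldType) (B : kcat k)
    (endB : forall b : ob B, end_reduced b) (b0 : ob B)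
    (C : kcat k) (F : kfunctor C B) (galF : galois_covering F)
    (theta : aut1 F -> pi1 b0)
    (thetaM : forall s t : aut1 F, theta (s * t)%g = (theta s * theta t)%g)
    (theta_bij : bijective theta) :
  exists Delta : {linear addchar k (pi1 b0) -> HH1 B},
    injective Delta /\
    forall (x : forall b : ob B, fibre F b) (chi : addchar k (pi1 b0)),
    exists D : derivation B,
      (forall (s : aut1 F) (b c : ob B) (f : khom b c),
         homogeneous x s f -> D b c f = chi (theta s) *: f) /\
      Delta chi = HH1_class D.
Proof.
have [[surjF _] _ _] := galF.
have pull_subproof (chi : addchar k (pi1 b0)) (s t : aut1 F) :
    chi (theta (s * t)%g) = chi (theta s) + chi (theta t).
  by rewrite thetaM addcharM.
pose pull chi := AddChar (pull_subproof chi).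
have der_exists (x : forall b, fibre F b) chi : exists2 D : derivation B,
    realizes D (pull chi) &
    forall (s : aut1 F) (b c : ob B) (f : khom b c),
      homogeneous x s f -> D b c f = chi (theta s) *: f.
  have [p pp px] := potential_exists galF (pull chi) x.
  have [D Dp] := scales_exists galF pp.
  by exists D; [exists p | exact: (scales_homogeneous pp px)].
pose x0 b : fibre F b :=
  exist _ (sval (cid (surjF b))) (svalP (cid (surjF b))).
(* The base points x0 only serve to choose representatives: by class_eq, any
   other derivation that realizes the same character has the same class. *)
pose D chi := s2val (cid2 (der_exists x0 chi)).
have Dreal chi : realizes (D chi) (pull chi).
  exact: (s2valP (cid2 (der_exists x0 chi))).
have class_eq (E E' : derivation B) (psi : aut1 F -> k) :
    realizes E psi -> realizes E' psi -> HH1_class E = HH1_class E'.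
  move=> rE rE'; apply/HH1_classP.
  have := realizes_linear (-1) rE' rE; rewrite scaleN1r addrC => rEE'.
  by apply: (realizes0_inner galF rEE') => s; rewrite mulN1r addNr.
have linDelta : linear (fun chi => HH1_class (D chi)).
  move=> a chi chi'; rewrite -HH1_class_linear.
  exact: (class_eq _ _ (pull (a *: chi + chi')) (Dreal _)
    (realizes_linear a (Dreal chi) (Dreal chi'))).
have [Delta DeltaE] := linear_pack linDelta.
exists Delta; split=> [chi chi'|x chi].
  rewrite !DeltaE => /HH1_classP inn.
  have := realizes_linear (-1) (Dreal chi') (Dreal chi).
  rewrite scaleN1r addrC => /inner_realizes0.
  have [y _] := surjF b0; move=> /(_ galF endB y inn) diff0.
  have [g _ gK] := theta_bij.
  apply: addchar_eq => u; have /= := diff0 (g u).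
  by rewrite gK mulN1r addrC => /eqP; rewrite subr_eq0 => /eqP.
have [E rE homE] := der_exists x chi.
by exists E; split=> //; rewrite DeltaE; exact: (class_eq _ _ _ (Dreal chi) rE).
Qed.
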